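(* Let $M$ be a set of binary strings. Suppose there exist a sequence of distinct finite sets $A_0,A_1,\dots$ and a sequence of positive reals $\epsilon_0,\epsilon_1,\dots$ with limit $0$ such that for every $n$: (i) $|M\cap A_n|\ge(1-\epsilon_n)\cdot|A_n|$, and (ii) every $x\in M\cap A_n$ satisfies $C(x)\ge C(A_n)+\log[C(A_n)]$. Then $M$ is not $(1,k)$-recursive for any positive integer $k$.
   Context: A set $A$ is $(m,k)$-recursive if there is a computable function $f$ mapping $k$-tuples to label vectors in $\{0,1\}^k$ such that for every tuple $(x_1,\dots,x_k)$ the vectors $(\chi_A(x_1),\dots,\chi_A(x_k))$ and $f(x_1,\dots,x_k)$ agree in at least $m$ positions. $C(\cdot)$ denotes plain Kolmogorov complexity with respect to a fixed universal machine; for a finite set $A$, $C(A)$ is the complexity of a canonical code of $A$. *)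

(* Defs.v *)
From mathcomp Require Import all_boot all_order all_algebra finmap.
From mathcomp Require Import boolp classical_sets reals topology normedtype.
From mathcomp Require Import sequences exp.

Set Implicit Arguments.
Unset Strict Implicit.
Unset Printing Implicit Defensive.

Import Order.TTheory GRing.Theory Num.Theory.

(** * Binary strings and their numbering *)

Definition bitstring := seq bool.

(* Bijective base-2 numeration, least significant digit first; the digits are
   1 (for [false]) and 2 (for [true]), so every natural number is the code of
   exactly one string. *)
Fixpoint code (s : bitstring) : nat :=
  if s is b :: s' then (code s').*2 + b.+1 else 0.

Fixpoint bs_succ (s : bitstring) : bitstring :=
  match s with
  | [::] => [:: false]
  | false :: s' => true :: s'
  | true :: s' => false :: bs_succ s'
  end.

Definition decode (n : nat) : bitstring := iter n bs_succ [::].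

Lemma code_succ s : code (bs_succ s) = (code s).+1.
Proof.
elim: s => [|[] s IHs] //=; last by rewrite addn1 addn2.
by rewrite IHs doubleS addn1 addn2.
Qed.

Lemma decodeK : cancel decode code.
Proof. by elim=> [|n IHn] //=; rewrite code_succ IHn. Qed.

Lemma code_inj : injective code.
Proof.
elim=> [|b s IHs] [|c t] //=; rewrite ?addnS // => -[] eq_st.
have eq_bc : b = c.
  by move/(congr1 odd): eq_st; rewrite !oddD !odd_double !oddb.
by move: eq_st; rewrite eq_bc => /addIn/double_inj/IHs ->.
Qed.

Lemma codeK : cancel code decode.
Proof. by move=> s; apply: code_inj; rewrite decodeK. Qed.

(** * Partial recursive functions *)

(* Kleene's mu-recursive functions: [recfun n] is the syntax of the [n]-ary
   ones. *)
Inductive recfun : nat -> Type :=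
| Zero n : recfun n
| Succ : recfun 1
| Proj n (i : 'I_n) : recfun n
| Comp m n (f : recfun m) (g : 'I_m -> recfun n) : recfun n
| Prec n (f : recfun n) (g : recfun n.+2) : recfun n.+1
| Mu n (f : recfun n.+1) : recfun n.

Fixpoint prec_graph (base : nat -> Prop) (step : nat -> nat -> nat -> Prop)
    (i y : nat) : Prop :=
  if i is j.+1 then exists2 z, prec_graph base step j z & step j z y
  else base y.

(* [eval e v y]: the computation of [e] on the arguments [v] halts with value
   [y].  In [Prec f g] the recursion argument comes first, and [g] receives the
   stage, the previous value and the parameters, in this order; in [Mu f] the
   minimised argument comes first, and [f] must be defined with a nonzero value
   at all smaller arguments. *)
Fixpoint eval n (e : recfun n) : n.-tuple nat -> nat -> Prop :=
  match e in recfun n0 return n0.-tuple nat -> nat -> Prop with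
  | Zero _ => fun _ y => y = 0
  | Succ => fun v y => y = (thead v).+1
  | Proj _ i => fun v y => y = tnth v i
  | Comp m _ f g => fun v y =>
      exists2 w : m.-tuple nat,
        (forall i, eval (g i) v (tnth w i)) & eval f w y
  | Prec _ f g => fun v y =>
      prec_graph (eval f [tuple of behead v])
        (fun j z => eval g [tuple of j :: z :: behead v]) (thead v) y
  | Mu _ f => fun v y =>
      eval f [tuple of y :: v] 0 /\
      forall z, z < y -> exists t, eval f [tuple of z :: v] t.+1
  end.

Lemma prec_graph_fun base step :
  (forall y z, base y -> base z -> y = z) ->
  (forall j x y z, step j x y -> step j x z -> y = z) ->
  forall i y z, prec_graph base step i y -> prec_graph base step i z -> y = z.
Proof.
move=> base_fun step_fun; elim=> [|i IHi] y z //=; first exact: base_fun.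
by move=> [a /IHi ia ay] [b /ia <-]; apply: step_fun ay.
Qed.

Lemma eval_fun n (e : recfun n) v y z : eval e v y -> eval e v z -> y = z.
Proof.
elim: e v y z => {n} [n||n i|m n f IHf g IHg|n f IHf g IHg|n f IHf] v y z /=.
- by move=> -> ->.
- by move=> -> ->.
- by move=> -> ->.
- move=> [w gw fy] [w' gw' fz]; apply: IHf fy _.
  suff -> : w = w' by [].
  by apply: eq_from_tnth => i; apply: IHg (gw i) (gw' i).
- by apply: prec_graph_fun => [? ?|? ? ? ?]; [apply: IHf | apply: IHg].
- move=> [fy lt_y] [fz lt_z]; case: (ltngtP y z) => // lt_yz.
  + by have [t ft] := lt_z _ lt_yz; have := IHf _ _ _ fy ft.
  + by have [t ft] := lt_y _ lt_yz; have := IHf _ _ _ fz ft.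
Qed.

(** * Machines and plain Kolmogorov complexity *)

(* [U p = None] means that [U] diverges on [p]. *)
Definition machine := bitstring -> option bitstring.

Definition partial_computable (U : machine) : Prop :=
  exists e : recfun 1,
    forall p x, U p = Some x <-> eval e [tuple code p] (code x).

(* Universality in the sense of the invariance theorem: [U] simulates every
   machine with an additive overhead in program length. *)
Definition universal (U : machine) : Prop :=
  partial_computable U /\
  forall V, partial_computable V ->
    exists c, forall p x, V p = Some x ->
      exists2 q, size q <= size p + c & U q = Some x.

Definition has_program (U : machine) (x : bitstring) (l : nat) : Prop :=
  exists2 p, size p = l & U p = Some x.

(* The value 0 for a string without any program is junk: when [U] is universal
   every string has a program, by simulation of the identity. *)
Definition complexity (U : machine) (x : bitstring) : nat :=
  match pselect (exists l, `[< has_program U x l >]) with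
  | left ex_l => ex_minn ex_l
  | right _ => 0
  end.

(* The canonical index of a finite set of natural numbers [D] is the sum of
   [2 ^ i] over the elements [i] of [D]. *)
Definition set_code (A : {fset bitstring}) : bitstring :=
  decode (\sum_(x <- A) 2 ^ code x).

Definition set_complexity (U : machine) (A : {fset bitstring}) : nat :=
  complexity U (set_code A).

(** * (m, k)-recursive sets *)

Definition computable_labelling k
    (f : k.-tuple bitstring -> k.-tuple bool) : Prop :=
  exists e : recfun k,
    forall x : k.-tuple bitstring,
      eval e [tuple of map code x] (code (f x)).

Definition mk_recursive (m k : nat) (A : set bitstring) : Prop :=
  exists2 f : k.-tuple bitstring -> k.-tuple bool,
    computable_labelling f &
    forall x : k.-tuple bitstring,
      m <= #|[set i | (tnth x i \in A) == tnth (f x) i]|.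

(* Only meaningful for [0 < x]; at [x = 0] the value is 0. *)
Definition log2 (R : realType) (x : R) : R := (ln x / ln 2)%R.

(* Main.v *)
(* Negating the labelling gives a computable [g] such that [g x] is never the
   vector of memberships of [x] in [M].  Given a finite set [A], let [v] be a
   most frequent value of [g] on [A^k].  For [z] in [A^k] count the [y] in [A^k]
   such that [g] takes the value [v] at the mixture having entry [y_i] where
   [v_i = 1] and [z_i] where [v_i = 0].  The average count is at least
   [|A|^k / 2^k], so a [z] found from [A] by conditional expectations reaches it.
   If no [z_i] were in [M], then every [y] in [M^k] would give a mixture whose
   membership vector is [v], hence would not be counted; so the count would be
   at most [k * epsilon * |A|^k], which is too small.  Thus some [z_i] is in [M].
   It is computed from [A] with [(v, i)] hardwired, so its complexity exceeds
   that of [A] by at most a constant, whereas the complexity of [A_n] is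
   unbounded. *)

Require Import Defs.
From mathcomp Require Import all_boot all_order all_algebra finmap.
From mathcomp Require Import boolp classical_sets reals topology normedtype.
From mathcomp Require Import sequences exp.
From mathcomp Require Import zify lra.
Import Order.TTheory GRing.Theory Num.Theory numFieldNormedType.Exports.

Set Implicit Arguments.
Unset Strict Implicit.
Unset Printing Implicit Defensive.

(** * Closure properties of recursive functions *)

Definition computable (n : nat) (F : seq nat -> nat) : Prop :=
  exists e : recfun n, forall v : n.-tuple nat, Defs.eval e v (F v).

Lemma eq_computable n F G :
  (forall v, size v = n -> F v = G v) -> computable n F -> computable n G.
Proof. by move=> FG [e eF]; exists e => v; rewrite -FG ?size_tuple. Qed.

Lemma computable_nth n i : computable n (fun v => nth 0 v i).
Proof.
have [lt_in|le_ni] := ltnP i n.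
  by exists (Proj (Ordinal lt_in)) => v /=; rewrite (tnth_nth 0).
by exists (Zero n) => v /=; rewrite nth_default ?size_tuple.
Qed.

Lemma computable_head n : computable n (head 0).
Proof. by apply: eq_computable (computable_nth n 0) => -[]. Qed.

Lemma computable_comp m n F (T : seq nat -> seq nat) :
  computable m F -> (forall v, size v = n -> size (T v) = m) ->
  (forall i, i < m -> computable n (fun v => nth 0 (T v) i)) ->
  computable n (fun v => F (T v)).
Proof.
move=> [e eF] sizeT compT.
have [g gT] := choice (fun i : 'I_m => compT i (ltn_ord i)).
exists (Comp e g) => v.
have sizeTv : size (T v) == m by rewrite sizeT ?size_tuple.
exists (Tuple sizeTv); last exact: eF.
by move=> i; rewrite (tnth_nth 0); apply: gT.
Qed.

Lemma computable_comp1 n F G :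
  computable 1 F -> computable n G -> computable n (fun v => F [:: G v]).
Proof. by move=> cF cG; apply: computable_comp cF _ _ => // -[]. Qed.

Lemma computable_let n F G :
  computable n.+1 F -> computable n G -> computable n (fun v => F (G v :: v)).
Proof.
move=> cF cG; apply: computable_comp cF _ _ => [v /= ->|[|i] _] //=.
exact: computable_nth.
Qed.

Lemma computable_iteri n B F G :
  computable n B -> computable n F -> computable n.+2 G ->
  computable n (fun v => iteri (B v) (fun j x => G [:: j, x & v]) (F v)).
Proof.
move=> cB [f fF] [g gG].
pose H v := iteri (head 0 v) (fun j x => G [:: j, x & behead v]) (F (behead v)).
suff cH : computable n.+1 H by apply: (computable_let cH cB).
exists (Prec f g) => v /=; rewrite /H.
have -> : head 0 v = thead v by case/tupleP: v.
elim: (thead v) => [|j IHj] /=.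
  by have := fF [tuple of behead v].
exists (iteri j (fun i x => G [:: i, x & behead v]) (F (behead v))) => //.
exact: (gG [tuple of j :: _ :: behead v]).
Qed.

Lemma computable_succ n F : computable n F -> computable n (fun v => (F v).+1).
Proof.
have cS : computable 1 (fun v => (head 0 v).+1).
  by exists Succ => v /=; case/tupleP: v.
exact: (computable_comp1 cS).
Qed.

Lemma computable_const n c : computable n (fun=> c).
Proof.
elim: c => [|c IHc]; first by exists (Zero n).
exact: computable_succ IHc.
Qed.

Lemma computable_add n F G :
  computable n F -> computable n G -> computable n (fun v => F v + G v).
Proof.
move=> cF cG.
have := computable_iteri cG cF
  (computable_succ (computable_nth n.+2 1)).
apply: eq_computable => v _ /=.
by elim: (G v) => [|x IHx] /=; rewrite ?addn0 ?addnS ?IHx.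
Qed.

Lemma computable_pred n F : computable n F -> computable n (fun v => (F v).-1).
Proof.
move=> cF.
have := computable_iteri cF (computable_const n 0) (computable_nth n.+2 0).
by apply: eq_computable => v _ /=; case: (F v).
Qed.

Lemma computable_sub n F G :
  computable n F -> computable n G -> computable n (fun v => F v - G v).
Proof.
move=> cF cG.
have := computable_iteri cG cF
  (computable_pred (computable_nth n.+2 1)).
apply: eq_computable => v _ /=.
by elim: (G v) => [|x IHx] /=; rewrite ?subn0 ?subnS ?IHx.
Qed.

Lemma computable_mul n F G :
  computable n F -> computable n G -> computable n (fun v => F v * G v).
Proof.
move=> cF cG.
have cF2 : computable n.+2 (fun v => F (behead (behead v))).
  apply: (@computable_comp n) cF _ _ => [v sz_v|i _].
    by rewrite !size_behead sz_v.
  apply: eq_computable (computable_nth n.+2 i.+2) => v _.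
  by rewrite !nth_behead.
have := computable_iteri cG (computable_const n 0)
  (computable_add (computable_nth n.+2 1) cF2).
apply: eq_computable => v _ /=.
by elim: (G v) => [|x IHx] /=; rewrite ?muln0 ?mulnS ?IHx // addnC.
Qed.

Lemma computable_leq n F G :
  computable n F -> computable n G -> computable n (fun v => F v <= G v : nat).
Proof.
move=> cF cG.
have := computable_sub (computable_const n 1) (computable_sub cF cG).
by apply: eq_computable => v _; rewrite /leq; case: (F v - G v).
Qed.

Lemma computable_eq n F G :
  computable n F -> computable n G -> computable n (fun v => F v == G v : nat).
Proof.
move=> cF cG.
have := computable_mul (computable_leq cF cG) (computable_leq cG cF).
by apply: eq_computable => v _; rewrite eqn_leq mulnb.
Qed.

Lemma computable_odd n F :
  computable n F -> computable n (fun v => odd (F v) : nat).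
Proof.
move=> cF.
have := computable_iteri cF (computable_const n 0)
  (computable_sub (computable_const n.+2 1) (computable_nth n.+2 1)).
apply: eq_computable => v _ /=.
by elim: (F v) => [|x IHx] //=; rewrite IHx; case: (odd x).
Qed.

Lemma computable_half n F : computable n F -> computable n (fun v => (F v)./2).
Proof.
move=> cF.
have := computable_iteri cF (computable_const n 0)
  (computable_sub (computable_nth n.+2 0) (computable_nth n.+2 1)).
apply: eq_computable => v _ /=.
elim: (F v) => [|x IHx] //; rewrite iteriS IHx -uphalfE.
by rewrite uphalf_half -{1}(odd_double_half x) -addnn addnA addnK.
Qed.

Lemma computable_iter_half n F G :
  computable n F -> computable n G ->
  computable n (fun v => iter (F v) half (G v)).
Proof.
move=> cF cG.
have := computable_iteri cF cG (computable_half (computable_nth n.+2 1)).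
by apply: eq_computable => v _ /=; elim: (F v) => //= x ->.
Qed.

Lemma computable_sum n B F :
  computable n B -> computable n.+1 F ->
  computable n (fun v => \sum_(i <- iota 0 (B v)) F (i :: v)).
Proof.
move=> cB cF.
have cF2 : computable n.+2 (fun v => F (head 0 v :: behead (behead v))).
  apply: (@computable_comp n.+1) cF _ _ => [v sz_v|[|i] _].
  - by rewrite /= !size_behead sz_v.
  - exact: computable_head.
  - apply: eq_computable (computable_nth n.+2 i.+2) => v _ /=.
    by rewrite !nth_behead.
have := computable_iteri cB (computable_const n 0)
  (computable_add (computable_nth n.+2 1) cF2).
apply: eq_computable => v _ /=.
have -> : iota 0 (B v) = index_iota 0 (B v) by rewrite /index_iota subn0.
elim: (B v) => [|x IHx]; first by rewrite big_geq.
by rewrite big_nat_recr //= IHx.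
Qed.

Lemma computable_find n B (P : seq nat -> bool) :
  computable n B -> computable n.+1 (fun v => P v : nat) ->
  computable n (fun v => find (fun x => P (x :: v)) (iota 0 (B v))).
Proof.
move=> cB cP.
have cB1 : computable n.+1 (fun v => B (behead v)).
  apply: (@computable_comp n) cB _ _ => [v sz_v|i _].
    by rewrite size_behead sz_v.
  apply: eq_computable (computable_nth n.+1 i.+1) => v _.
  by rewrite nth_behead.
have [e eH] : computable n.+1
    (fun v => ((head 0 v).+1 <= B (behead v)) * (1 - P v)).
  apply: computable_mul; last first.
    by apply: computable_sub cP; apply: computable_const.
  apply: computable_leq cB1; apply: computable_succ.
  exact: computable_head.
exists (Mu e) => v /=; set y := find _ _; split.
  have := eH [tuple of y :: v]; rewrite /=.
  suff -> : (y < B v) * (1 - P (y :: v)) = 0 by [].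
  case: ltnP => // lt_yB.
  have hasP : has (fun x => P (x :: v)) (iota 0 (B v)).
    by rewrite has_find size_iota.
  by have := nth_find 0 hasP; rewrite -/y nth_iota // add0n => ->.
move=> z lt_zy; exists 0; have := eH [tuple of z :: v]; rewrite /=.
have lt_zB : z < B v.
  by apply: leq_trans lt_zy _; rewrite -[leqRHS](size_iota 0) find_size.
by have := before_find 0 lt_zy; rewrite nth_iota // add0n lt_zB => ->.
Qed.

(** * Canonical indices and conditional expectations *)

(* The elements of the set with canonical index [a]. *)
Definition elems (a : nat) : seq nat :=
  [seq i <- iota 0 a | odd (iter i half a)].

Lemma sum_exp2_uniq s : uniq s ->
  \sum_(x <- s) 2 ^ x =
    (0 \in s) + (\sum_(x <- [seq x.-1 | x <- s & 0 < x]) 2 ^ x).*2.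
Proof.
elim: s => [|[|x] s IHs]; first by rewrite !big_nil.
  by rewrite big_cons inE => /= /andP[/negPf s'0 /IHs ->]; rewrite s'0.
by rewrite /= !big_cons inE => /andP[_ /IHs ->]; rewrite expnS /=; lia.
Qed.

Lemma odd_iter_half_sum s i :
  uniq s -> odd (iter i half (\sum_(x <- s) 2 ^ x)) = (i \in s).
Proof.
elim: i s => [|i IHi] s uniq_s.
  by rewrite /= sum_exp2_uniq // oddD odd_double oddb addbF.
rewrite iterSr sum_exp2_uniq // half_bit_double IHi; last first.
  rewrite map_inj_in_uniq ?filter_uniq // => -[|x] [|y];
    by rewrite !mem_filter //= => _ _ ->.
apply/mapP/idP => [[[|x]]|s_i]; rewrite ?mem_filter //=; first by move=> ? ->.
by exists i.+1; rewrite ?mem_filter.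
Qed.

Lemma mem_elems_sum s i : uniq s -> (i \in elems (\sum_(x <- s) 2 ^ x)) = (i \in s).
Proof.
move=> uniq_s; rewrite mem_filter odd_iter_half_sum // mem_iota /= add0n.
apply: andb_idr => s_i; rewrite (perm_big _ (perm_to_rem s_i)) big_cons /=.
by apply: leq_trans (leq_addr _ _); rewrite ltn_expl.
Qed.

Lemma computable_sum_elems n F :
  computable n.+2 (fun v => F (head 0 v) (behead v)) ->
  computable n.+1
    (fun v => \sum_(i <- elems (head 0 v)) F (head 0 v) (i :: behead v)).
Proof.
move=> cF.
have cF2 : computable n.+2
    (fun v => F (nth 0 v 1) (nth 0 v 0 :: behead (behead v))).
  apply: (@computable_comp n.+2 _ _
    (fun v => [:: nth 0 v 1, nth 0 v 0 & behead (behead v)])) cF _ _ => [v sz_v|].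
    by rewrite /= !size_behead sz_v.
  move=> [|[|i]] _; [exact: computable_nth|exact: computable_nth|].
  by apply: eq_computable (computable_nth _ i.+2) => v _; rewrite /= !nth_behead.
have := computable_sum (@computable_head n.+1) (computable_mul (computable_odd
  (computable_iter_half (computable_nth n.+2 0) (computable_nth n.+2 1))) cF2).
apply: eq_computable => -[//|a t] _ /=; rewrite /elems big_filter [RHS]big_mkcond.
by apply: eq_bigr => i _; case: odd; rewrite ?mul1n ?mul0n.
Qed.

Fixpoint lists (s : seq nat) (j : nat) : seq (seq nat) :=
  if j is i.+1 then [seq x :: y | x <- s, y <- lists s i] else [:: [::]].

Lemma size_lists s j : size (lists s j) = size s ^ j.
Proof. by elim: j => [|j IHj] //=; rewrite size_allpairs IHj expnS. Qed.

Lemma mem_listsS s j x y :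
  (x :: y \in lists s j.+1) = (x \in s) && (y \in lists s j).
Proof.
apply/allpairsP/andP => [[[a b] /= [? ? [-> ->]]]|[? ?]] //.
by exists (x, y).
Qed.

Lemma mem_lists s j y : (y \in lists s j) = (size y == j) && all (mem s) y.
Proof.
elim: j y => [|j IHj] [|x y] //.
  by apply/negbTE/negP => /allpairsP[? []].
by rewrite mem_listsS IHj /= eqSS andbCA.
Qed.

Lemma big_listsS s j (F : seq nat -> nat) :
  \sum_(y <- lists s j.+1) F y = \sum_(x <- s) \sum_(y <- lists s j) F (x :: y).
Proof. by rewrite /= big_allpairs_dep. Qed.

Lemma big_lists_rcons s j (F : seq nat -> nat) :
  \sum_(y <- lists s j.+1) F y = \sum_(x <- s) \sum_(y <- lists s j) F (rcons y x).
Proof.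
elim: j F => [|j IHj] F.
  by rewrite big_listsS; apply: eq_bigr => x _; rewrite !big_seq1.
rewrite big_listsS; under eq_bigr do rewrite IHj.
rewrite exchange_big /=; apply: eq_bigr => x _.
by rewrite big_listsS.
Qed.

Lemma computable_sum_lists n j F :
  computable (n + j).+1 (fun v => F (head 0 v) (behead v)) ->
  computable n.+1 (fun v =>
    \sum_(y <- lists (elems (head 0 v)) j) F (head 0 v) (y ++ behead v)).
Proof.
elim: j n F => [|j IHj] n F cF.
  by rewrite addn0 in cF; apply: eq_computable cF => v _; rewrite big_seq1.
have := IHj n (fun a t => \sum_(x <- elems a) F a (x :: t)).
rewrite addnS in cF => /(_ (computable_sum_elems cF)).
by apply: eq_computable => v _; rewrite big_listsS exchange_big.
Qed.

Definition pick_large (a i : nat) (G : seq nat -> nat) (t : seq nat) : nat :=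
  let W x := \sum_(y <- lists (elems a) i) G (y ++ x :: t) in
  find (fun x => (odd (iter x half a)) &&
          (\sum_(x' <- elems a) W x' <= size (elems a) * W x)) (iota 0 a).

(* Method of conditional expectations: each new entry keeps the average of [G]
   over the remaining entries at least as large as before. *)
Fixpoint greedy (a j : nat) (G : seq nat -> nat) (t : seq nat) : seq nat :=
  if j is i.+1 then greedy a i G (pick_large a i G t :: t) else t.

Lemma leq_sum_max (s : seq nat) (W : nat -> nat) : 0 < size s ->
  exists2 x, x \in s & \sum_(y <- s) W y <= size s * W x.
Proof.
elim: s => // x s IHs _; case: (posnP (size s)) => [/size0nil ->|/IHs[z s_z le_z]].
  by exists x; rewrite ?mem_head // big_seq1 mul1n.
case: (leqP (W x) (W z)) => [le_xz|/ltnW le_zx].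
  by exists z; rewrite ?inE ?s_z ?orbT // big_cons mulSn leq_add.
exists x; rewrite ?mem_head // big_cons mulSn leq_add2l.
by apply: leq_trans le_z _; rewrite leq_mul2l le_zx orbT.
Qed.

Lemma pick_largeP a i G t : 0 < size (elems a) ->
  pick_large a i G t \in elems a /\
  \sum_(x <- elems a) \sum_(y <- lists (elems a) i) G (y ++ x :: t) <=
    size (elems a) *
      \sum_(y <- lists (elems a) i) G (y ++ pick_large a i G t :: t).
Proof.
pose W x := \sum_(y <- lists (elems a) i) G (y ++ x :: t).
move=> /(@leq_sum_max _ W)[x]; rewrite mem_filter => /andP[odd_x a_x] le_x.
rewrite /pick_large -/W; set P := fun _ => _ && _.
have hasP : has P (iota 0 a) by apply/hasP; exists x; rewrite /P ?odd_x.
have lt_a : find P (iota 0 a) < a by rewrite -[ltnRHS](size_iota 0) -has_find.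
have := nth_find 0 hasP; rewrite nth_iota // add0n => /andP[odd_p le_p].
by rewrite mem_filter odd_p mem_iota.
Qed.

Lemma greedyP a j G t : 0 < size (elems a) ->
  exists2 z, z \in lists (elems a) j & greedy a j G t = z ++ t /\
    \sum_(y <- lists (elems a) j) G (y ++ t) <= size (elems a) ^ j * G (z ++ t).
Proof.
move=> a_gt0; elim: j t => [|j IHj] t.
  by exists [::] => //; rewrite big_seq1 mul1n.
have [a_p le_p] := pick_largeP j G t a_gt0.
have [z a_z [eq_z le_z]] := IHj (pick_large a j G t :: t).
exists (rcons z (pick_large a j G t)).
  move: a_z; rewrite !mem_lists size_rcons eqSS => /andP[-> a_z].
  by rewrite all_rcons /= a_p.
rewrite cat_rcons; split=> //; rewrite big_lists_rcons expnS -mulnA.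
under eq_bigr do under eq_bigr do rewrite cat_rcons.
by apply: leq_trans le_p _; rewrite leq_mul2l le_z orbT.
Qed.

Lemma computable_size_elems n F : computable n F ->
  computable n (fun v => size (elems (F v))).
Proof.
move=> cF.
have := computable_sum_elems (F := fun _ _ => 1) (computable_const 2 1).
move/(computable_comp1 (n := n))/(_ cF).
by apply: eq_computable => v _ /=; rewrite sum1_size.
Qed.

Lemma computable_greedy n j G H :
  computable (n + j).+1 (fun v => G (head 0 v) (behead v)) ->
  computable (n + j).+1 (fun v => H (head 0 v) (behead v)) ->
  computable n.+1
    (fun v => H (head 0 v) (greedy (head 0 v) j (G (head 0 v)) (behead v))).
Proof.
elim: j n => [|j IHj] n cG cH /=; first by rewrite addn0 in cH.
rewrite addnS -addSn in cG cH.
pose W a t := \sum_(y <- lists (elems a) j) G a (y ++ t).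
have cW : computable n.+2 (fun v => W (head 0 v) (behead v)).
  exact: computable_sum_lists.
have cS := computable_sum_elems cW.
have cp : computable n.+1
    (fun v => pick_large (head 0 v) j (G (head 0 v)) (behead v)).
  pose P v := odd (iter (nth 0 v 0) half (nth 0 v 1)) &&
    (\sum_(x' <- elems (nth 0 v 1)) W (nth 0 v 1) (x' :: behead (behead v)) <=
       size (elems (nth 0 v 1)) *
         W (nth 0 v 1) (nth 0 v 0 :: behead (behead v))).
  have cP : computable n.+2 (fun v => P v : nat).
    have c0 := computable_nth n.+2 0; have c1 := computable_nth n.+2 1.
    have cW' : computable n.+2
        (fun v => W (nth 0 v 1) (nth 0 v 0 :: behead (behead v))).
      apply: (@computable_comp n.+2 _ _
        (fun v => [:: nth 0 v 1, nth 0 v 0 & behead (behead v)])) cW _ _ => [v sz_v|].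
        by rewrite /= !size_behead sz_v.
      move=> [|[|i]] _ //.
      by apply: eq_computable (computable_nth _ i.+2) => v _; rewrite /= !nth_behead.
    have cS' : computable n.+2 (fun v => \sum_(x' <- elems (nth 0 v 1))
        W (nth 0 v 1) (x' :: behead (behead v))).
      apply: (@computable_comp n.+1 _ _
        (fun v => nth 0 v 1 :: behead (behead v))) cS _ _ => [v sz_v|].
        by rewrite /= !size_behead sz_v.
      move=> [|i] _; first exact: computable_nth.
      by apply: eq_computable (computable_nth _ i.+2) => v _; rewrite /= !nth_behead.
    have := computable_mul (computable_odd (computable_iter_half c0 c1))
      (computable_leq cS' (computable_mul (computable_size_elems c1) cW')).
    by apply: eq_computable => v _; rewrite mulnb.
  by have := computable_find (@computable_head n.+1) cP; apply: eq_computable => -[].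
have := IHj n.+1 cG cH.
move/(@computable_comp _ n.+1 _ (fun v => [:: head 0 v,
  pick_large (head 0 v) j (G (head 0 v)) (behead v) & behead v])); apply.
  by move=> v sz_v; rewrite /= size_behead sz_v.
move=> [|[|i]] _ //; first exact: computable_head.
by apply: eq_computable (computable_nth _ i.+1) => v _; rewrite /= nth_behead.
Qed.

(** * Existence of a hitting tuple *)

Definition mix (v : seq bool) (z y : seq nat) : seq nat :=
  mkseq (fun i => nth 0 (if nth false v i then y else z) i) (size v).

Lemma mix_cons b v p z q y :
  mix (b :: v) (p :: z) (q :: y) = (if b then q else p) :: mix v z y.
Proof.
rewrite /mix /mkseq /= -[1]/(1 + 0) iotaDl -map_comp; case: b;
  by congr (_ :: _); apply: eq_map => i /=; case: (nth false v i).
Qed.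

Lemma sum_seq_const (T : Type) (s : seq T) c : \sum_(i <- s) c = size s * c.
Proof. by rewrite big_const_seq count_predT iter_addn_0 mulnC. Qed.

Lemma sum_mix (s : seq nat) (v : seq bool) (F : seq nat -> nat) :
  \sum_(z <- lists s (size v)) \sum_(y <- lists s (size v)) F (mix v z y) =
  size s ^ size v * \sum_(x <- lists s (size v)) F x.
Proof.
elim: v F => [|b v IHv] F; first by rewrite !big_seq1 mul1n.
rewrite [size _]/= !big_listsS.
under eq_bigr do under eq_bigr do rewrite big_listsS.
under eq_bigr do rewrite exchange_big.
under eq_bigr do under eq_bigr do under eq_bigr do under eq_bigr do rewrite mix_cons.
under eq_bigr do under eq_bigr do rewrite (IHv (fun x => F (_ :: x))).
case: b; last under eq_bigr do rewrite sum_seq_const mulnA -expnS.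
  by rewrite sum_seq_const -big_distrr mulnA -expnS.
by rewrite -big_distrr.
Qed.

(* Multiplied by [size s], so that the exponent on the right stays [k]. *)
Lemma count_lists_bad (s : seq nat) (m : pred nat) k :
  count (predC (all m)) (lists s k) * size s <=
    k * count (predC m) s * size s ^ k.
Proof.
elim: k => [|k IHk] //.
have le_step : count (predC (all m)) (lists s k.+1) <=
    size s * count (predC (all m)) (lists s k) + count (predC m) s * size s ^ k.
  rewrite -!sum1_count [leqLHS]big_mkcond [in leqRHS]big_mkcond big_listsS /=.
  rewrite [X in _ + X * _]big_mkcond big_distrl /= -sum_seq_const.
  rewrite -big_split /= leq_sum // => x _; case: (m x) => /=.
    by rewrite mul0n addn0.
  by rewrite sum1_size size_lists mul1n leq_addl.
have := leq_mul le_step (leqnn (size s)); rewrite expnS; nia.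
Qed.

Lemma popular_label (T : finType) (s : seq (seq nat)) (g : seq nat -> T) :
  0 < #|T| ->
  exists v, size s <= #|T| * count (fun x => g x == v) s.
Proof.
move=> /card_gt0P[v0 _].
pose c v := count (fun x => g x == v) s.
exists [arg max_(v > v0) c v]; case: arg_maxnP => //= v _ max_v.
have <- : \sum_w c w = size s.
  rewrite -[RHS]sum1_size /c.
  under eq_bigr do rewrite -sum1_count big_mkcond.
  rewrite exchange_big; apply: eq_bigr => x _ /=.
  by rewrite -big_mkcond (big_pred1 (g x)).
by rewrite -sum_nat_const leq_sum // => w _; apply: max_v.
Qed.

Lemma exists_hitting_label k (s : seq nat) (m : pred nat)
    (g : seq nat -> k.-tuple bool) :
  (forall x, size x = k ->
     exists2 i, i < k & m (nth 0 x i) != nth false (g x) i) ->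
  count (predC m) s * (k * 2 ^ k) < size s ->
  exists v : k.-tuple bool, forall z, z \in lists s k ->
    \sum_(z' <- lists s k) \sum_(y <- lists s k) (g (mix v z' y) == v) <=
      size s ^ k * \sum_(y <- lists s k) (g (mix v z y) == v) ->
    exists2 i, i < k & m (nth 0 z i).
Proof.
move=> g_ne sparse.
have [|v] := popular_label (lists s k) g; first by rewrite card_tuple card_bool expn_gt0.
rewrite card_tuple card_bool size_lists => popular; exists v => z.
rewrite mem_lists => /andP[/eqP size_z _].
have := sum_mix s v (fun x => g x == v); rewrite size_tuple => ->.
have s_gt0 : 0 < size s by apply: leq_ltn_trans sparse.
have sk_gt0 : 0 < size s ^ k by rewrite expn_gt0 s_gt0.
rewrite leq_pmul2l // -!big_mkcond /= !sum1_count => le_z.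
case: (boolP [exists i : 'I_k, m (nth 0 z i)]) => [/existsP[i mi]|/existsPn no_m].
  by exists i.
have le_bad : count (fun y => g (mix v z y) == v) (lists s k) <=
    count (predC (all m)) (lists s k).
  rewrite -!sum1_count 2![\sum_(i <- _ | _) _]big_mkcond !big_seq.
  apply: leq_sum => y; rewrite mem_lists => /andP[/eqP size_y _] /=.
  case: eqP => // gv; case: (boolP (all m y)) => //= all_y.
  have size_mix : size (mix v z y) = k by rewrite size_mkseq size_tuple.
  have [i lt_ik] := g_ne _ size_mix; rewrite gv nth_mkseq ?size_tuple //.
  case vi: (nth false v i).
    by rewrite (allP all_y) // mem_nth // size_y.
  by have /negPf-> := no_m (Ordinal lt_ik).
have le_bad_k := count_lists_bad s m k.
suff : size s ^ k * size s <= size s ^ k * (count (predC m) s * (k * 2 ^ k)).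
  by rewrite leq_pmul2l // leqNgt sparse.
apply: leq_trans (leq_mul popular (leqnn _)) _.
apply: leq_trans (_ : 2 ^ k * (k * count (predC m) s * size s ^ k) <= _); last by lia.
rewrite -mulnA leq_mul2l; apply/orP; right; apply: leq_trans le_bad_k.
by rewrite leq_mul2r (leq_trans le_z le_bad) orbT.
Qed.

(** * Kolmogorov complexity *)

Lemma complexity_le (U : machine) p x : U p = Some x -> complexity U x <= size p.
Proof.
move=> Up; rewrite /complexity; case: pselect => [ex_l|[]].
  by case: ex_minnP => l _; apply; apply/asboolP; exists p.
by exists (size p); apply/asboolP; exists p.
Qed.

Lemma partial_computable_comp (U : machine) h :
  partial_computable U -> computable 1 h ->
  partial_computable (fun p => omap (fun x => decode (h [:: code x])) (U p)).
Proof.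
move=> [e eU] [e' e'h]; exists (Comp e' (fun=> e)) => p x; split=> /=.
  case Up: (U p) => [y|] //= [<-]; exists [tuple code y].
    by move=> i; rewrite (ord1 i); apply/eU.
  by rewrite decodeK; apply: e'h.
move=> [w ew e'x]; have := ew ord0; rewrite -[tnth w _]decodeK => /eU -> /=.
have w_eq : w = [tuple tnth w ord0].
  by apply: eq_from_tnth => i; rewrite (ord1 i).
rewrite w_eq in e'x.
by rewrite decodeK -[[:: _]]/(tval [tuple tnth w ord0]) (eval_fun (e'h _) e'x) codeK.
Qed.

Lemma complexityP (U : machine) x : universal U ->
  exists2 p, size p = complexity U x & U p = Some x.
Proof.
move=> [_ simU].
have [|c simc] := simU Some.
  exists (Proj ord0) => p y; rewrite /= tnth0.
  by split=> [[->]|/code_inj ->].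
rewrite /complexity; case: pselect => [ex_l|[]].
  by case: ex_minnP => l /asboolP.
by have [q _ Uq] := simc x x erefl; exists (size q); apply/asboolP; exists q.
Qed.

Lemma complexity_computable (U : machine) h : universal U -> computable 1 h ->
  exists c, forall x, complexity U (decode (h [:: code x])) <= complexity U x + c.
Proof.
move=> univU ch; have [pcU simU] := univU.
have [c simc] := simU _ (partial_computable_comp pcU ch); exists c => x.
have [p <- Up] := complexityP x univU.
have [|q le_q /complexity_le le_qx] := simc p (decode (h [:: code x])).
  by rewrite Up.
exact: leq_trans le_q.
Qed.

Lemma code_lt (s : bitstring) : code s < 2 ^ (size s).+1.
Proof.
suff : (code s).+1 < 2 ^ (size s).+1 by exact: ltnW.
elim: s => [|b s IHs] //=; rewrite expnS; move: (2 ^ _) IHs => m.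
by case: b => /=; lia.
Qed.

Lemma complexity_unbounded (U : machine) (x : nat -> bitstring) n0 L :
  universal U -> injective x -> exists2 n, n0 <= n & L < complexity U (x n).
Proof.
move=> univU inj_x; apply: contrapT => no_n.
have bound n : n0 <= n -> complexity U (x n) <= L.
  by move=> le_n; rewrite leqNgt; apply/negP => lt_L; apply: no_n; exists n.
have xP n : exists p, size p = complexity U (x n) /\ U p = Some (x n).
  by have [p] := complexityP (x n) univU; exists p.
have [p pP] := choice xP.
have lt_p (i : 'I_(2 ^ L.+1).+1) : code (p (n0 + i)) < 2 ^ L.+1.
  apply: leq_trans (code_lt _) _; rewrite leq_exp2l // ltnS (pP _).1.
  by rewrite bound ?leq_addr.
have : injective (fun i => Ordinal (lt_p i)).
  move=> i j [/code_inj eq_p]; apply/val_inj/(@addnI n0)/inj_x/Some_inj.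
  by rewrite -(pP _).2 eq_p (pP _).2.
by move=> /leq_card; rewrite !card_ord ltnn.
Qed.

Lemma code_set_code (A : {fset bitstring}) :
  code (set_code A) = \sum_(i <- map code A) 2 ^ i.
Proof. by rewrite /set_code decodeK big_map. Qed.

Lemma mem_elems_set_code (A : {fset bitstring}) i :
  (i \in elems (code (set_code A))) = (i \in map code A).
Proof.
by rewrite code_set_code mem_elems_sum // (map_inj_uniq code_inj) fset_uniq.
Qed.

Lemma perm_elems_set_code (A : {fset bitstring}) :
  perm_eq (elems (code (set_code A))) (map code A).
Proof.
apply: uniq_perm => [||i]; last exact: mem_elems_set_code.
  by rewrite filter_uniq // iota_uniq.
by rewrite (map_inj_uniq code_inj) fset_uniq.
Qed.

Lemma set_code_inj : injective set_code.
Proof.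
move=> A B eqAB; apply/fsetP => x.
by rewrite -(mem_map code_inj) -mem_elems_set_code eqAB mem_elems_set_code mem_map //;
  exact: code_inj.
Qed.

Definition excluded k (f : k.-tuple bitstring -> k.-tuple bool)
    (l : seq nat) : k.-tuple bool :=
  [tuple of map negb (f [tuple decode (nth 0 l i) | i < k])].

Definition popularity k (f : k.-tuple bitstring -> k.-tuple bool)
    (v : k.-tuple bool) (a : nat) (z : seq nat) : nat :=
  \sum_(y <- lists (elems a) k)
    (excluded f (mix v (drop k (y ++ z)) (take k (y ++ z))) == v).

Definition popular_list k (f : k.-tuple bitstring -> k.-tuple bool)
    (v : k.-tuple bool) (a : nat) : seq nat :=
  greedy a k (popularity f v a) [::].

Lemma popularityE k (f : k.-tuple bitstring -> k.-tuple bool)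
    (v : k.-tuple bool) a z :
  popularity f v a z =
    \sum_(y <- lists (elems a) k) (excluded f (mix v z y) == v).
Proof.
rewrite /popularity !big_seq; apply: eq_bigr => y.
by rewrite mem_lists => /andP[/eqP sz_y _]; rewrite drop_size_cat // take_size_cat.
Qed.

Lemma popular_listP k (f : k.-tuple bitstring -> k.-tuple bool)
    (v : k.-tuple bool) a : 0 < size (elems a) ->
  popular_list f v a \in lists (elems a) k /\
  \sum_(z <- lists (elems a) k) \sum_(y <- lists (elems a) k)
      (excluded f (mix v z y) == v) <=
    size (elems a) ^ k *
      \sum_(y <- lists (elems a) k) (excluded f (mix v (popular_list f v a) y) == v).
Proof.
move=> a_gt0.
have [z a_z [eq_z le_z]] := greedyP k (popularity f v a) [::] a_gt0.
rewrite cats0 in eq_z le_z; rewrite /popular_list eq_z -popularityE; split=> //.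
by apply: leq_trans le_z; under [leqRHS]eq_bigr do rewrite cats0 popularityE.
Qed.

Lemma computable_excluded k (f : k.-tuple bitstring -> k.-tuple bool) :
  computable_labelling f ->
  computable k (fun l => code (f [tuple decode (nth 0 l i) | i < k])).
Proof.
move=> [e ef]; exists e => v.
suff {1}-> : v = [tuple of map code [tuple decode (nth 0 v i) | i < k]] by apply: ef.
by apply: eq_from_tnth => i; rewrite tnth_map tnth_mktuple decodeK (tnth_nth 0).
Qed.

Lemma computable_popularity k (f : k.-tuple bitstring -> k.-tuple bool)
    (v : k.-tuple bool) : computable_labelling f ->
  computable k.+1 (fun w => popularity f v (head 0 w) (behead w)).
Proof.
move=> /computable_excluded cf.
pose F (a : nat) u : nat := excluded f (mix v (drop k u) (take k u)) == v.
apply: (@computable_sum_lists k k F).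
pose T w := mix v (drop k (behead w)) (take k (behead w)).
have cT : computable (k + k).+1
    (fun w => code (f [tuple decode (nth 0 (T w) i) | i < k])).
  apply: (computable_comp (T := T) cf) => [w _|i lt_ik].
    by rewrite size_mkseq size_tuple.
  apply: eq_computable
    (computable_nth _ (if nth false v i then i.+1 else (k + i).+1)) => w _.
  rewrite nth_mkseq ?size_tuple //; case: ifP => _.
    by rewrite nth_take // nth_behead.
  by rewrite nth_drop nth_behead.
have := computable_eq cT (computable_const _ (code (map negb v))).
apply: eq_computable => w _ /=; rewrite /F (inj_eq code_inj) -!val_eqE /=.
by rewrite -(inj_eq (inj_map negb_inj)) -map_comp (eq_map negbK) map_id.
Qed.

Lemma computable_popular_list k (f : k.-tuple bitstring -> k.-tuple bool)
    (v : k.-tuple bool) i : computable_labelling f ->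
  computable 1 (fun w => nth 0 (popular_list f v (head 0 w)) i).
Proof.
move=> cf.
have c_nth : computable (0 + k).+1 (fun w => nth 0 (behead w) i).
  by apply: eq_computable (computable_nth _ i.+1) => w _; rewrite nth_behead.
have := computable_greedy (n := 0) (j := k)
  (G := popularity f v) (H := fun _ t => nth 0 t i)
  (computable_popularity v cf) c_nth.
by apply: eq_computable => -[|a []].
Qed.

Lemma exists_simple_member (U : machine) (M : set bitstring) k
    (f : k.-tuple bitstring -> k.-tuple bool) :
  universal U -> computable_labelling f ->
  (forall x, exists i, (tnth x i \in M) = tnth (f x) i) ->
  exists c, forall A : {fset bitstring},
    count [predC M] A * (k * 2 ^ k) < size A ->
    exists x, [/\ x \in A, x \in M & complexity U x <= set_complexity U A + c].
Proof.
move=> univU cf fM.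
have cP (vi : k.-tuple bool * 'I_k) := complexity_computable univU
  (computable_popular_list vi.1 vi.2 cf).
have [c c_le] := choice cP.
exists (\max_vi c vi) => A sparse.
pose a := code (set_code A).
pose m : pred nat := fun n => decode n \in M.
have perm_a := perm_elems_set_code A.
have [x sz_x||v hit] := @exists_hitting_label k (elems a) m (@excluded k f).
- have [i fi] := fM [tuple decode (nth 0 x i) | i < k].
  exists i => //; rewrite (nth_map false) ?size_tuple // /m.
  by rewrite -tnth_nth -fi tnth_mktuple; case: (_ \in M).
- rewrite (perm_size perm_a) size_map (permP perm_a) count_map.
  by rewrite (eq_count (a2 := [predC M])) // => x; rewrite /= /m codeK.
have a_gt0 : 0 < size (elems a).
  by rewrite (perm_size perm_a) size_map; apply: leq_ltn_trans sparse.
have [a_z le_z] := popular_listP f v a_gt0.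
have [i lt_ik m_i] := hit _ a_z le_z.
exists (decode (nth 0 (popular_list f v a) i)); split=> //.
  have : nth 0 (popular_list f v a) i \in elems a.
    move: a_z; rewrite mem_lists => /andP[/eqP sz_z /allP]; apply.
    by rewrite mem_nth // sz_z.
  by rewrite (perm_mem perm_a) => /mapP[x A_x ->]; rewrite codeK.
apply: leq_trans (c_le (v, Ordinal lt_ik) (set_code A)) _.
by rewrite leq_add2l (leq_bigmax (v, Ordinal lt_ik)).
Qed.

Unset Implicit Arguments.

Local Open Scope classical_set_scope.
Local Open Scope fset_scope.
Local Open Scope ring_scope.

Theorem theorem2p9 (R : realType) (U : machine) (U_universal : universal U)
    (M : set bitstring) (A : nat -> {fset bitstring}) (epsilon : nat -> R)
    (A_distinct : injective A)
    (epsilon_gt0 : forall n, 0 < epsilon n)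
    (epsilon_cvg0 : epsilon n @[n --> \oo] --> (0 : R))
    (M_dense : forall n,
       (#|` [fset x in A n | x \in M]|)%:R >=
         (1 - epsilon n) * (#|` A n|)%:R)
    (M_complex : forall n x, x \in M -> x \in A n ->
       (complexity U x)%:R >=
         (set_complexity U (A n))%:R
           + log2 ((set_complexity U (A n))%:R : R))
    (k : nat) (k_gt0 : (0 < k)%N) :
  ~ mk_recursive 1 k M.
Proof.
move=> [f cf f_hit].
have f_agree x : exists i, (tnth x i \in M) = tnth (f x) i.
  by have /card_gt0P[i] := f_hit x; rewrite inE => /eqP; exists i.
have [c simple] := exists_simple_member U_universal cf f_agree.
pose K := (k * 2 ^ k)%N.
have K_gt0 : (0 < K)%N by rewrite muln_gt0 k_gt0 expn_gt0.
have [n0 _ eps_small] : \forall n \near \oo, epsilon n < K%:R^-1.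
  apply: (cvgr_lt _ epsilon_cvg0); by rewrite invr_gt0 ltr0n.
pose L := maxn (2 ^ c) (complexity U (set_code fset0)).
have [n le_n] := complexity_unbounded n0 L U_universal (inj_comp set_code_inj A_distinct).
rewrite gtn_max /= => /andP[big_c big_0].
have A_gt0 : (0 < size (A n))%N.
  rewrite lt0n [size _ == 0]cardfs_eq0; apply: contraTneq big_0 => ->.
  by rewrite ltnn.
have dense_count : (#|` [fset x in A n | x \in M]|)%fset =
    count (fun x => x \in M) (A n).
  rewrite -size_filter; apply/perm_size/uniq_perm; rewrite ?filter_uniq //.
  by move=> x; rewrite !inE mem_filter andbC.
have /simple[x [A_x M_x le_x]] : (count [predC M] (A n) * K < size (A n))%N.
  move: A_gt0 (M_dense n); rewrite dense_count.
  have <- := count_predC (fun x => x \in M) (A n).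
  set good := count _ _; set bad := count _ _ => A_gt0 dense.
  have le_bad : (bad%:R : R) <= epsilon n * (good + bad)%:R.
    by move: dense; rewrite natrD; lra.
  rewrite -(ltr_nat R) natrM mulrC -ltr_pdivlMl ?ltr0n //.
  by apply: le_lt_trans le_bad _; rewrite ltr_pM2r ?ltr0n // eps_small.
have := M_complex n x M_x A_x.
apply/negP; rewrite -ltNge.
apply: (@le_lt_trans _ _ ((set_complexity U (A n) + c)%:R : R)).
  by rewrite ler_nat.
rewrite natrD ltrD2l /log2 ltr_pdivlMr; last by rewrite ln_gt0 // ltr1n.
rewrite mulr_natl -lnXn ?ltr0n // ltr_ln ?posrE ?exprn_gt0 ?ltr0n //.
  by rewrite -natrX ltr_nat.
exact: leq_trans big_c.
Qed.
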